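(* (Arc-length geometry ODE and reduced dynamics for invariant cones.) Let $f:\mathbb R^n\to\mathbb R^n$ be the positively homogeneous piecewise linear vector field described in the context, with $n=2N$, and for $g\in\mathbb R^n$ put $$T(g):=f(g)-\bigl(g^{\top}f(g)\bigr)\,g .$$ Let $G:\mathbb R\to\mathbb R^n$ be a curve with $\|G(s)\|=1$ for all $s$ and $\|G'(s)\|=1$ wherever $G$ is differentiable. Suppose a trajectory of $\dot x=f(x)$ lies on the cone $\{rG(s): r\ge0,\ s\in\mathbb R\}$ and is written as $x(t)=r(t)\,G(s(t))$ with $r(t)>0$ and $s$ nondecreasing. Then, at every time $t$ at which $r,s$ are differentiable, $G$ is differentiable at $s=s(t)$ and $\dot x(t)=f(x(t))$ holds, one has $$\frac{\dot r}{r}=G(s)^{\top}f(G(s)),\qquad \dot s=\|T(G(s))\|,$$ and, whenever $T(G(s))\ne 0$, $$G'(s)=\frac{T(G(s))}{\|T(G(s))\|}.$$ Moreover, if neither $A^+$ nor $A^-$ has a real eigenvalue, then $T(g)\neq 0$ for every $g\in\mathbb R^n$ with $\|g\|=1$.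
   Context: $\|\cdot\|$ is the Euclidean norm. Let $N\ge 1$, let $M,C,K\in\mathbb R^{N\times N}$ be symmetric with $M$ and $K$ positive definite, let $w\in\mathbb R^N$, $k_n>0$, $c_n\ge0$. Write states as $x=(q,\dot q)\in\mathbb R^{2N}$ and set $$A^-=\begin{bmatrix}0&I\\-M^{-1}K&-M^{-1}C\end{bmatrix},\qquad A^+=\begin{bmatrix}0&I\\-M^{-1}(K+k_nww^{\top})&-M^{-1}(C+c_nww^{\top})\end{bmatrix}.$$ With $h_\alpha(x)=w^{\top}q$ and $h_\beta(x)=k_nw^{\top}q+c_nw^{\top}\dot q$, let $\mathcal V^-=\{x: h_\alpha(x)<0\text{ or }h_\beta(x)<0\}$. The vector field is $f(x)=A^-x$ if $x\in\mathcal V^-$ and $f(x)=A^+x$ otherwise; it satisfies $f(\beta x)=\beta f(x)$ for all $\beta>0$. *)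

(* Defs.v *)
From HB Require Import structures.
From mathcomp Require Import all_boot all_order all_algebra.
From mathcomp Require Import all_classical all_reals all_analysis.

Set Implicit Arguments.
Unset Strict Implicit.
Unset Printing Implicit Defensive.

Import Order.TTheory GRing.Theory Num.Theory.
Import numFieldNormedType.Exports.

Local Open Scope classical_set_scope.
Local Open Scope ring_scope.

Definition dotv (R : realType) (n : nat) (u v : 'cV[R]_n) : R :=
  (u^T *m v) 0 0.

(* The library norm `|u| on matrices is the sup norm, so the Euclidean norm is
   defined here. Both induce the same topology, hence the same derivatives. *)
Definition enorm (R : realType) (n : nat) (u : 'cV[R]_n) : R :=
  Num.sqrt (dotv u u).

Definition posdefmx (R : realType) (n : nat) (A : 'M[R]_n) : Prop :=
  forall v : 'cV[R]_n, v != 0 -> 0 < dotv v (A *m v).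

(* States x = (q, q') are column vectors of height N + N, with
   q = usubmx x and q' = dsubmx x. *)
Definition Aminus (R : realType) (N : nat) (M C K : 'M[R]_N) : 'M[R]_(N + N) :=
  block_mx 0 1%:M (- (invmx M *m K)) (- (invmx M *m C)).

Definition Aplus (R : realType) (N : nat) (M C K : 'M[R]_N) (w : 'cV[R]_N)
    (kn cn : R) : 'M[R]_(N + N) :=
  block_mx 0 1%:M
    (- (invmx M *m (K + kn *: (w *m w^T))))
    (- (invmx M *m (C + cn *: (w *m w^T)))).

Definition h_alpha (R : realType) (N : nat) (w : 'cV[R]_N)
    (x : 'cV[R]_(N + N)) : R :=
  dotv w (usubmx x).

Definition h_beta (R : realType) (N : nat) (w : 'cV[R]_N) (kn cn : R)
    (x : 'cV[R]_(N + N)) : R :=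
  kn * dotv w (usubmx x) + cn * dotv w (dsubmx x).

Definition Vminus (R : realType) (N : nat) (w : 'cV[R]_N) (kn cn : R) :
    set 'cV[R]_(N + N) :=
  [set x | h_alpha w x < 0 \/ h_beta w kn cn x < 0].

Definition vfield (R : realType) (N : nat) (M C K : 'M[R]_N) (w : 'cV[R]_N)
    (kn cn : R) (x : 'cV[R]_(N + N)) : 'cV[R]_(N + N) :=
  if x \in Vminus w kn cn then Aminus M C K *m x
  else Aplus M C K w kn cn *m x.

Definition tangent (R : realType) (n : nat) (f : 'cV[R]_n -> 'cV[R]_n)
    (g : 'cV[R]_n) : 'cV[R]_n :=
  f g - dotv g (f g) *: g.

Definition cone_of (R : realType) (n : nat) (G : R -> 'cV[R]_n) :
    set 'cV[R]_n :=
  [set y | exists rho sigma : R, 0 <= rho /\ y = rho *: G sigma].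

(* Solution of x' = f(x) on the interval J. As f may be discontinuous, x' = f(x)
   can fail at switching times, so solutions are taken in Caratheodory's sense
   (absolutely continuous on compact subintervals, x' = f(x) almost everywhere),
   written coordinatewise in the equivalent integral form. *)
Definition trajectory (R : realType) (n : nat) (f : 'cV[R]_n -> 'cV[R]_n)
    (J : set R) (x : R -> 'cV[R]_n) : Prop :=
  forall (a b : R) (i : 'I_n), J a -> J b -> a <= b ->
    (@lebesgue_measure R).-integrable `[a, b] (fun u => (f (x u) i 0)%:E) /\
    x b i 0 = x a i 0 + \int[@lebesgue_measure R]_(u in `[a, b]) (f (x u) i 0).

(* Main.v *)
Require Import Defs.
From HB Require Import structures.
From mathcomp Require Import all_boot all_order all_algebra.
From mathcomp Require Import ring.
From mathcomp Require Import all_classical all_reals all_analysis.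
Import Order.TTheory GRing.Theory Num.Theory.
Import numFieldNormedType.Exports.
Local Open Scope classical_set_scope.
Local Open Scope ring_scope.

(** Homogeneity of [f] and differentiation of [x = r G(s)] give [r' G + r s' G' = r f(G)]. As [G]
    has unit length, [G'] is orthogonal to [G] ([dotv_derive1_enorm1]), so the radial part of this
    equation is the law for [r'/r] and the tangential part is [s' G' = T(G)] ([polar_ode]). Since
    [s' >= 0] ([nondecreasing_derive1_ge0]) and [G'] is a unit vector, taking norms gives [s'], and
    dividing by it gives [G']. Finally, [T(g) = 0] makes [g] an eigenvector, with real eigenvalue
    [g . f(g)], of whichever matrix is active at [g] ([eigenvalue_col]). *)

Lemma dotvE (R : realType) (n : nat) (u v : 'cV[R]_n) :
  dotv u v = \sum_i u i 0 * v i 0.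
Proof. by rewrite /dotv mxE; apply: eq_bigr => i _; rewrite mxE. Qed.

Lemma dotvZr (R : realType) (n : nat) (a : R) (u v : 'cV[R]_n) :
  dotv u (a *: v) = a * dotv u v.
Proof. by rewrite /dotv -scalemxAr mxE. Qed.

Lemma dotvZl (R : realType) (n : nat) (a : R) (u v : 'cV[R]_n) :
  dotv (a *: u) v = a * dotv u v.
Proof. by rewrite /dotv linearZ -scalemxAl mxE. Qed.

Lemma dotvDr (R : realType) (n : nat) (u v w : 'cV[R]_n) :
  dotv u (v + w) = dotv u v + dotv u w.
Proof. by rewrite /dotv mulmxDr mxE. Qed.

Lemma dotv_ge0 (R : realType) (n : nat) (u : 'cV[R]_n) : 0 <= dotv u u.
Proof. by rewrite dotvE sumr_ge0 // => i _; rewrite -expr2 sqr_ge0. Qed.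

Lemma enormZ (R : realType) (n : nat) (a : R) (u : 'cV[R]_n) :
  enorm (a *: u) = `|a| * enorm u.
Proof.
by rewrite /enorm dotvZl dotvZr mulrA -expr2 sqrtrM ?sqr_ge0// sqrtr_sqr.
Qed.

Lemma dotv_enorm1 (R : realType) (n : nat) (u : 'cV[R]_n) :
  enorm u = 1 -> dotv u u = 1.
Proof. by move=> u1; rewrite -(sqr_sqrtr (dotv_ge0 _ _ u)) -/(enorm u) u1 expr1n. Qed.

Lemma is_derive1_coord (R : realType) (m n : nat) (F : R -> 'M[R]_(m, n))
    (t : R) (i : 'I_m) (j : 'I_n) :
  derivable F t 1 -> is_derive t 1 (fun u => F u i j) (derive1 F t i j).
Proof.
move=> dF; apply: DeriveDef; first by move/derivable_mxP: dF; apply.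
by rewrite derive1E derive_mx// mxE.
Qed.

(** Differentiating the constant [G . G = 1] gives [2 (G . G') = 0]. *)
Lemma dotv_derive1_enorm1 (R : realType) (n : nat) (G : R -> 'cV[R]_n) (t : R) :
  (forall u, enorm (G u) = 1) -> derivable G t 1 -> dotv (G t) (derive1 G t) = 0.
Proof.
move=> G1 dG.
have d1 : is_derive t 1 (\sum_(i < n) (fun u => G u i 0 * G u i 0))
    (\sum_(i < n) (G t i 0 * derive1 G t i 0 + G t i 0 * derive1 G t i 0)).
  apply: is_derive_sum => i; have dGi := is_derive1_coord _ _ _ _ _ i 0 dG.
  exact: is_deriveM.
have e1 : \sum_(i < n) (fun u => G u i 0 * G u i 0) = cst 1.
  by apply/funext => u; rewrite fct_sumE -dotvE dotv_enorm1.
move: d1; rewrite e1 => /@derive_val; rewrite derive_cst big_split /= -dotvE.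
by move/esym/eqP; rewrite -mulr2n mulrn_eq0 /= => /eqP.
Qed.

(** The scalar product and chain rules, applied in each coordinate. The polar form is assumed only
    near [t], because a trajectory has it only on its time interval. *)
Lemma derive1_scale_comp (R : realType) (n : nat) (G x : R -> 'cV[R]_n)
    (r s : R -> R) (t : R) :
  (\near t, x t = r t *: G (s t)) ->
  derivable r t 1 -> derivable s t 1 -> derivable G (s t) 1 ->
  derivable x t 1 ->
  derive1 x t = derive1 r t *: G (s t) + (r t * derive1 s t) *: derive1 G (s t).
Proof.
move=> xE dr ds dG dx; apply/matrixP => i j; rewrite (ord1 j) !mxE.
have [_ <-] := is_derive1_coord _ _ _ _ _ i 0 dx.
have dGi := is_derive1_coord _ _ _ _ _ i 0 dG.
have ds' : is_derive t 1 s (derive1 s t) by apply: DeriveDef; rewrite ?derive1E.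
have dr' : is_derive t 1 r (derive1 r t) by apply: DeriveDef; rewrite ?derive1E.
have dGs := is_derive1_comp dGi ds'.
have := is_deriveM dr' dGs.
have : \near t, (r * ((fun u => G u i 0) \o s)) t = x t i 0.
  by apply: filterS xE => u /= ->; rewrite mxE.
move=> /near_eq_is_derive /[apply] /@derive_val ->.
by rewrite /= /GRing.scale /=; ring.
Qed.

Lemma nondecreasing_derive1_ge0 (R : realType) (J : set R) (s : R -> R) (t : R) :
  (forall u v, J u -> J v -> u <= v -> s u <= s v) ->
  interior J t -> derivable s t 1 -> 0 <= derive1 s t.
Proof.
move=> smono Jt ds; rewrite derive1E /derive.
apply: limr_ge; first exact: ds.
(* Monotonicity is known on [J] only, so the increments must be small enough to stay inside [J]. *)
have Jh : \forall h \near 0^', J (h *: (1 : R) + t).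
  apply: cvg_within; rewrite /= near_simpl.
  have : (h *: (1 : R) + t) @[h --> (0 : R)] --> (0 : R) *: (1 : R) + t.
    by apply: cvgD; [apply: cvgZl; exact: cvg_id|exact: cvg_cst].
  by rewrite scale0r add0r => /(_ J Jt).
have Jt0 : J t by exact: interior_subset.
near=> h.
have h0 : h != 0 by near: h; exact: nbhs_dnbhs_neq.
have Jht : J (h *: (1 : R) + t) by near: h.
have hE : h *: (1 : R) = h by rewrite /GRing.scale /= mulr1.
rewrite hE in Jht *; rewrite /GRing.scale /=.
(* The increment of [s] has the sign of [h], so the difference quotient is nonnegative on both
   sides. *)
have [hlt|hgt|/eqP] := ltgtP h 0; last by rewrite (negPf h0).
  rewrite nmulr_rge0 ?invr_lt0// subr_le0 smono//.
  by rewrite gerDr ltW.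
by rewrite mulr_ge0 ?invr_ge0 ?(ltW hgt)// subr_ge0 smono// lerDr ltW.
Unshelve. all: by end_near.
Qed.

(* Since [G . G' = 0], the equation [x' = r' G + r s' G' = r f(G)] splits into
   its component along [G] and the one orthogonal to it. *)
Lemma polar_ode (R : realType) (n : nat) (f : 'cV[R]_n -> 'cV[R]_n)
    (G x : R -> 'cV[R]_n) (r s : R -> R) (t : R) :
  (forall a y, 0 < a -> f (a *: y) = a *: f y) ->
  (forall u, enorm (G u) = 1) ->
  (\near t, x t = r t *: G (s t)) -> 0 < r t ->
  derivable r t 1 -> derivable s t 1 -> derivable G (s t) 1 ->
  derivable x t 1 -> derive1 x t = f (x t) ->
  derive1 r t / r t = dotv (G (s t)) (f (G (s t))) /\
  derive1 s t *: derive1 G (s t) = tangent f (G (s t)).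
Proof.
move=> fhom G1 xE r0 dr ds dG dx.
rewrite (derive1_scale_comp _ _ _ _ _ _ _ xE)// (nbhs_singleton xE) fhom// => ode.
(* The dot product of the equation with [G] kills the [G'] term. *)
have r'E : derive1 r t = r t * dotv (G (s t)) (f (G (s t))).
  rewrite -dotvZr -ode dotvDr !dotvZr dotv_derive1_enorm1// dotv_enorm1//.
  by rewrite mulr0 addr0 mulr1.
split; first by rewrite r'E mulrAC divff ?mul1r ?gt_eqF.
(* Multiplied by [r t], the claim is the equation with its radial part moved to the other side. *)
apply: (scalerI (a := r t)); first by rewrite gt_eqF.
by rewrite /tangent scalerBr -ode r'E !scalerA addrAC subrr add0r.
Qed.

(** Both switching functions are linear, so positive scaling preserves their signs and hence the
    choice of matrix. *)
Lemma vfieldZ (R : realType) (N : nat) (M C K : 'M[R]_N) (w : 'cV[R]_N)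
    (kn cn a : R) (x : 'cV[R]_(N + N)) : 0 < a ->
  vfield M C K w kn cn (a *: x) = a *: vfield M C K w kn cn x.
Proof.
move=> a0; rewrite /vfield.
have -> : (a *: x \in Vminus w kn cn) = (x \in Vminus w kn cn).
  apply/idP/idP; rewrite !inE /Vminus /= /h_alpha /h_beta !linearZ /= !dotvZr;
    by rewrite !(mulrCA _ a) -mulrDr !pmulr_rlt0.
by case: ifP => _; rewrite scalemxAr.
Qed.

(** [eigenvalue] is defined through row vectors, [v *m A = a *: v]. A column eigenvector serves as
    well, since it makes the square matrix [A - a] singular. *)
Lemma eigenvalue_col (F : fieldType) (n : nat) (A : 'M[F]_n) (a : F)
    (g : 'cV[F]_n) : g != 0 -> A *m g = a *: g -> eigenvalue A a.
Proof.
move=> g0 Ag; rewrite /eigenvalue /eigenspace kermx_eq0 row_free_unit.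
apply: contraNN g0 => /mulKmx /(_ g) <-.
by rewrite mulmxBl Ag mul_scalar_mx subrr mulmx0.
Qed.

Theorem mainTheorem4 (R : realType) (N : nat) (hN : (1 <= N)%N)
  (M C K : 'M[R]_N) (w : 'cV[R]_N) (kn cn : R)
  (symM : M^T = M) (symC : C^T = C) (symK : K^T = K)
  (posM : posdefmx M) (posK : posdefmx K)
  (hkn : 0 < kn) (hcn : 0 <= cn) :
  let f := vfield M C K w kn cn in
  let T := tangent f in
  (forall (G : R -> 'cV[R]_(N + N)),
     continuous G ->
     (forall sigma : R, enorm (G sigma) = 1) ->
     (forall sigma : R, derivable G sigma 1 -> enorm (derive1 G sigma) = 1) ->
   forall (J : set R) (x : R -> 'cV[R]_(N + N)) (r s : R -> R),
     is_interval J ->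
     trajectory f J x ->
     (forall u : R, J u -> cone_of G (x u)) ->
     (forall u : R, J u -> x u = r u *: G (s u)) ->
     (forall u : R, J u -> 0 < r u) ->
     (forall u v : R, J u -> J v -> u <= v -> s u <= s v) ->
   forall t : R, interior J t ->
     derivable r t 1 ->
     derivable s t 1 ->
     derivable G (s t) 1 ->
     derivable x t 1 ->
     derive1 x t = f (x t) ->
     [/\ derive1 r t / r t = dotv (G (s t)) (f (G (s t))),
         derive1 s t = enorm (T (G (s t)))
       & T (G (s t)) != 0 ->
         derive1 G (s t) = (enorm (T (G (s t))))^-1 *: T (G (s t))])
  /\
  ((forall lambda : R, ~~ eigenvalue (Aplus M C K w kn cn) lambda) ->
   (forall lambda : R, ~~ eigenvalue (Aminus M C K) lambda) ->
   forall g : 'cV[R]_(N + N), enorm g = 1 -> T g != 0).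
Proof.
move=> f T; split; last first.
  move=> eigP eigM g g1.
  have g0 : g != 0.
    by apply: contra_eq_neq g1 => ->; rewrite /enorm /dotv mulmx0 mxE sqrtr0 eq_sym oner_eq0.
  (* [T g = 0] reads [f g = (g . f g) g], and [f g] is one of the two matrices applied to [g]. *)
  apply/negP; rewrite subr_eq0 {1}/f /vfield => /eqP.
  by case: ifP => _ /(eigenvalue_col _ _ _ _ _ g0); apply/negP.
move=> G _ G1 G'1 J x r s _ _ _ xE r0 smono t Jt dr ds dG dx ode.
have Jt0 : J t by exact: interior_subset.
have xEt : \near t, x t = r t *: G (s t) by apply: filterS Jt => u; exact: xE.
have fhom a y : 0 < a -> f (a *: y) = a *: f y by exact: vfieldZ.
have [r'E s'G'] := polar_ode _ _ _ _ _ _ _ _ fhom G1 xEt (r0 _ Jt0) dr ds dG dx ode.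
have s'E : derive1 s t = enorm (T (G (s t))).
  rewrite /T -s'G' enormZ G'1// mulr1 ger0_norm//.
  exact: nondecreasing_derive1_ge0 smono Jt ds.
split=> // T0; rewrite -s'E /T -s'G' scalerA mulVf ?scale1r//.
(* The division by [s'] is legitimate: [s' = 0] would force [T(G) = s' G' = 0]. *)
by apply: contra_neq T0 => s'0; rewrite /T -s'G' s'0 scale0r.
Qed.
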